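(* In the setting of the Pauli-path expansion described in the context, let $k\ge0$ be an integer and let $\widetilde A_L:=\sum_{\gamma:\ r(\gamma)\le k}\mathrm{coef}(\gamma)\,Q_L(\gamma)$ be the operator obtained by discarding every Pauli path with more than $k$ non-identity updates. If $k>eL\tau$, then $$\|A_L-\widetilde A_L\|_1\;\le\;2^n\,e^{\tau L}\Big(\frac{eL\tau}{k}\Big)^{k},$$ where $\|\cdot\|_1$ is the trace norm.
   Context: Pauli-path expansion. Let $n\ge1$ and $\mathcal P_n=\{I,X,Y,Z\}^{\otimes n}$. Fix $\tau>0$, an integer $L\ge1$, and a sequence $P_1,\dots,P_L$ of Hermitian operators, each of the form $\pm P$ with $P\in\mathcal P_n\setminus\{I^{\otimes n}\}$. Define $\mathcal E_t(X)=e^{-\tau P_t/2}\,X\,e^{-\tau P_t/2}$ and $A_L:=\mathcal E_L\circ\cdots\circ\mathcal E_1(\mathbb I)$. For $Q\in\mathcal P_n$: if $P_t$ anticommutes with $Q$ then $\mathcal E_t(Q)=Q$; if $P_t$ commutes with $Q$ then $\mathcal E_t(Q)=\cosh(\tau)Q-\sinh(\tau)P_tQ$, where $P_tQ=s\,Q'$ for a unique sign $s\in\{\pm1\}$ and $Q'\in\mathcal P_n$. A Pauli path is a sequence $\gamma=(Q_0,Q_1,\dots,Q_L)$ of elements of $\mathcal P_n$ with $Q_0=\mathbb I$ such that for each $t\in\{1,\dots,L\}$ exactly one of the following holds: (a) $P_t$ anticommutes with $Q_{t-1}$ and $Q_t=Q_{t-1}$ (step factor $1$); (b) $P_t$ commutes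 with $Q_{t-1}$ and $Q_t=Q_{t-1}$ (step factor $\cosh\tau$); (c) $P_t$ commutes with $Q_{t-1}$ and $Q_t=Q'$ where $P_tQ_{t-1}=sQ'$ (step factor $-s\sinh\tau$; this is called a non-identity update). $\mathrm{coef}(\gamma)$ is the product of the $L$ step factors, $r(\gamma)$ is the number of non-identity updates, and $Q_t(\gamma)$ denotes the $t$-th entry. Then $A_L=\sum_\gamma\mathrm{coef}(\gamma)\,Q_L(\gamma)$, the sum ranging over all Pauli paths. *)

(* Defs.v *)
(* MathComp + real_closed (complex numbers R[i]) +
   MathComp-Analysis (realType, expR). *)
From HB Require Import structures.
From mathcomp Require Import all_boot all_order all_algebra.
From mathcomp Require Import complex.
From mathcomp Require Import reals sequences exp.

Set Implicit Arguments.
Unset Strict Implicit.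
Unset Printing Implicit Defensive.

Import Order.TTheory GRing.Theory Num.Theory.
Local Open Scope ring_scope.

Section Pauli.
Variable R : realType.
Local Notation C := (R[i]).

(* real scalars embedded in C *)
Definition rC (x : R) : C := (x%:C)%C.

Definition coshR (x : R) : R := (expR x + expR (- x)) / 2.
Definition sinhR (x : R) : R := (expR x - expR (- x)) / 2.

(* single-qubit Pauli labels: 0 = I, 1 = X, 2 = Y, 3 = Z *)
Definition pauli1_entry (a : 'I_4) (r c : 'I_2) : C :=
  match val a with
  | 0 => (r == c)%:R
  | 1 => (r != c)%:R
  | 2 => if r == c then 0 else if val r == 0 then - 'i else 'i
  | _ => if r == c then (if val r == 0 then 1 else -1) else 0
  end.

(* a Pauli string on n qubits: an element of {I,X,Y,Z}^n *)
Definition pstring (n : nat) := {ffun 'I_n -> 'I_4}.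

Definition pstring_id (n : nat) : pstring n := [ffun => ord0].

(* k-th bit of the basis-state index i *)
Definition qbit (N : nat) (k : nat) (i : 'I_N) : 'I_2 := inord (odd (i %/ 2 ^ k)).

(* the 2^n x 2^n matrix of a Pauli string (tensor product of the factors) *)
Definition pmat (n : nat) (q : pstring n) : 'M[C]_(2 ^ n) :=
  \matrix_(i, j) \prod_(k < n) pauli1_entry (q k) (qbit k i) (qbit k j).

(* the signed generator P_t = (-1)^(sg t) * p t *)
Definition genP (n : nat) (sg : nat -> bool) (p : nat -> pstring n) (t : nat)
  : 'M[C]_(2 ^ n) := (-1) ^+ sg t *: pmat (p t).

(* e^{-tau P_t / 2}, written through P_t^2 = I as cosh(tau/2) I - sinh(tau/2) P_t *)
Definition expGen (n : nat) (tau : R) (sg : nat -> bool) (p : nat -> pstring n)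
  (t : nat) : 'M[C]_(2 ^ n) :=
  rC (coshR (tau / 2)) *: 1%:M - rC (sinhR (tau / 2)) *: genP sg p t.

(* A_m = E_m o ... o E_1 (identity) *)
Fixpoint Aop (n : nat) (tau : R) (sg : nat -> bool) (p : nat -> pstring n)
  (m : nat) : 'M[C]_(2 ^ n) :=
  match m with
  | 0 => 1%:M
  | m'.+1 => expGen tau sg p m' *m Aop tau sg p m' *m expGen tau sg p m'
  end.

Definition commutes (N : nat) (A B : 'M[C]_N) : bool := A *m B == B *m A.

(* step cases for step t (generator P_{t+1} with 0-based index t), from q to q' *)
Definition step_a n sg p t (q q' : pstring n) : bool :=
  ~~ commutes (genP sg p t) (pmat q) && (q' == q).
Definition step_b n sg p t (q q' : pstring n) : bool :=
  commutes (genP sg p t) (pmat q) && (q' == q).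
(* non-identity update: P_t Q = s Q' with s = +1 or s = -1 *)
Definition step_c n sg p t (q q' : pstring n) : bool :=
  commutes (genP sg p t) (pmat q) &&
  ((genP sg p t *m pmat q == pmat q') || (genP sg p t *m pmat q == - pmat q')).

Definition step_factor n (tau : R) sg p t (q q' : pstring n) : C :=
  if step_a sg p t q q' then 1
  else if step_b sg p t q q' then rC (coshR tau)
  else if genP sg p t *m pmat q == pmat q' then - rC (sinhR tau)
  else rC (sinhR tau).

(* Pauli paths gamma = (Q_0, ..., Q_L), gamma (inord t) = Q_t *)
Definition path_at n L (g : {ffun 'I_L.+1 -> pstring n}) (t : nat) : pstring n :=
  g (inord t).

Definition is_path n L sg p (g : {ffun 'I_L.+1 -> pstring n}) : bool :=
  (path_at g 0 == pstring_id n) &&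
  [forall t : 'I_L,
     let q := path_at g t in let q' := path_at g t.+1 in
     [|| step_a sg p t q q', step_b sg p t q q' | step_c sg p t q q']].

Definition coef n (tau : R) L sg p (g : {ffun 'I_L.+1 -> pstring n}) : C :=
  \prod_(t < L) step_factor tau sg p t (path_at g t) (path_at g t.+1).

Definition nupdates n L sg p (g : {ffun 'I_L.+1 -> pstring n}) : nat :=
  \sum_(t < L) step_c sg p t (path_at g t) (path_at g t.+1).

(* truncated operator: paths with at most k non-identity updates *)
Definition Atrunc n (tau : R) L sg p (k : nat) : 'M[C]_(2 ^ n) :=
  \sum_(g : {ffun 'I_L.+1 -> pstring n} | is_path sg p g && (nupdates sg p g <= k)%N)
     coef tau sg p g *: pmat (path_at g L).

(* trace norm: sum of the singular values, i.e. of the square roots of the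
   eigenvalues (with multiplicity) of M^* M *)
Definition adjmx N (M : 'M[C]_N) : 'M[C]_N := (map_mx (fun z => z^*) M)^T.

Definition trace_norm N (M : 'M[C]_N) : C :=
  \sum_(z <- sval (closed_field_poly_normal (char_poly (adjmx M *m M)))) sqrtC z.

End Pauli.

(* Main.v *)
(** The discarded operator is a sum of Pauli matrices, so its trace norm is at
    most [2 ^ n] times the sum of the absolute values of the coefficients of the
    discarded paths: for any [c > 0], [sqrt z <= (z / c + c) / 2] on the
    eigenvalues of [M^* M] reduces the trace norm to the Frobenius norm. Weighting
    each non-identity update by [x >= 1], the sum of [|coef| x ^ r] over all paths
    is at most [(cosh tau + x sinh tau) ^ L <= e ^ ((1 + x) tau L)], since every
    entry has at most two successors. Dividing by [x ^ k] with
    [x = k / (L tau)] gives the bound. *)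
Require Import Defs.
From HB Require Import structures.
From mathcomp Require Import all_boot all_order all_algebra.
From mathcomp Require Import complex.
From mathcomp Require Import reals sequences exp.
From mathcomp Require Import ring lra.
Import Order.TTheory GRing.Theory Num.Theory.
Local Open Scope ring_scope.
Set Implicit Arguments.
Unset Strict Implicit.
Unset Printing Implicit Defensive.

(** * Bits of basis-state indices *)

Lemma qbit_inj n (i j : 'I_(2 ^ n)) :
  (forall k : 'I_n, qbit k i = qbit k j) -> i = j.
Proof.
move=> h; apply: val_inj; case: i j h => i li [j lj] /= h.
have {}h k : (k < n)%N -> odd (i %/ 2 ^ k) = odd (j %/ 2 ^ k).
  move=> lk; have /(congr1 val) := h (Ordinal lk); rewrite /qbit /=.
  by rewrite !inordK; do 2?[case: odd].
(* Bit 0 fixes the parity; the remaining bits are those of [i %/ 2], to which induction applies. *)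
elim: n i j li lj h => [|n IH] i j; first by case: i; case: j.
rewrite expnS mulnC => li lj h.
have h0 := h 0%N isT; rewrite expn0 !divn1 in h0.
rewrite (divn_eq i 2) (divn_eq j 2) !modn2 h0 (IH (i %/ 2)%N (j %/ 2)%N) //.
- by rewrite ltn_divLR.
- by rewrite ltn_divLR.
- by move=> k lk; rewrite -!divnMA -expnS; apply: h.
Qed.

(** The bit map is injective between sets of the same size, hence a bijection, so this is
    distributivity. It reduces products and traces of Pauli strings to single-qubit computations. *)
Lemma sum_prod_qbit (R : comPzSemiRingType) n (F : 'I_n -> 'I_2 -> R) :
  \sum_(i < 2 ^ n) \prod_(k < n) F k (qbit k i) = \prod_(k < n) \sum_b F k b.
Proof.
rewrite bigA_distr_bigA /=.
pose f (i : 'I_(2 ^ n)) := [ffun k : 'I_n => qbit k i].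
have f_inj : injective f.
  by move=> i j /ffunP fij; apply: qbit_inj => k; have := fij k; rewrite !ffunE.
have f_bij : bijective f.
  by apply: inj_card_bij => //; rewrite card_ffun !card_ord.
rewrite (reindex f) /=; last exact: onW_bij.
by apply: eq_bigr => i _; apply: eq_bigr => k _; rewrite ffunE.
Qed.

(** * Multiplication, trace and commutation of Pauli strings *)

Section PauliAlgebra.
Variable R : realType.
Local Notation C := (R[i]).

(** The Klein four-group law: Pauli multiplication modulo phases. *)
Definition pauli1_mul (a b : 'I_4) : 'I_4 :=
  match val a, val b with
  | 0, _ => b
  | _, 0 => a
  | 1, 1 | 2, 2 | 3, 3 => ord0
  | 1, 2 | 2, 1 => @Ordinal 4 3 isT
  | 1, _ | _, 1 => @Ordinal 4 2 isT
  | _, _ => @Ordinal 4 1 isT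
  end.

Definition pauli1_phase (a b : 'I_4) : C :=
  match val a, val b with
  | 1, 2 | 2, 3 | 3, 1 => 'i
  | 2, 1 | 3, 2 | 1, 3 => - 'i
  | _, _ => 1
  end.

Lemma pauli1_entryM (a b : 'I_4) (r c : 'I_2) :
  \sum_s pauli1_entry R a r s * pauli1_entry R b s c
  = pauli1_phase a b * pauli1_entry R (pauli1_mul a b) r c.
Proof.
have ii : ('i : C) * 'i = -1 by rewrite -expr2 sqrCi.
rewrite !big_ord_recl big_ord0.
by case: a => -[|[|[|[|//]]]] ?; case: b => -[|[|[|[|//]]]] ?;
   case: r => -[|[|//]] ?; case: c => -[|[|//]] ?;
   rewrite /pauli1_entry /pauli1_phase /pauli1_mul -!val_eqE /= -?val_eqE /=;
   ring: ii.
Qed.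

Lemma pauli1_mul_eq0 a b : pauli1_mul a b = ord0 -> a = b.
Proof.
move=> /(congr1 val) h; apply: val_inj; move: h.
by case: a => -[|[|[|[|//]]]] ?; case: b => -[|[|[|[|//]]]].
Qed.

(** Phases are fourth roots of unity, and reversing the factors inverts the phase; the dichotomy
    between commuting and anticommuting rests on these two facts. *)
Lemma pauli1_phaseC a b :
  pauli1_phase a b * pauli1_phase b a = 1 /\ pauli1_phase a b ^+ 4 = 1.
Proof.
have ii : ('i : C) ^+ 2 = -1 by rewrite sqrCi.
by case: a => -[|[|[|[|//]]]] ?; case: b => -[|[|[|[|//]]]] ?; 
   split; rewrite /pauli1_phase /=; ring: ii.
Qed.

Lemma pauli1_mulC a b : pauli1_mul a b = pauli1_mul b a.
Proof.
by apply: val_inj; case: a => -[|[|[|[|//]]]] ?; case: b => -[|[|[|[|//]]]].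
Qed.

Lemma conj_pauli1_entry a r c :
  (pauli1_entry R a r c)^* = pauli1_entry R a c r.
Proof.
by case: a => -[|[|[|[|//]]]] ?; case: r => -[|[|//]] ?; case: c => -[|[|//]] ?;
   rewrite /pauli1_entry -?val_eqE /= ?rmorphN /= ?conjCi ?opprK ?rmorph0 ?rmorph1.
Qed.

Variable n : nat.
Implicit Types q r : pstring n.

Definition pstring_mul q r : pstring n := [ffun k => pauli1_mul (q k) (r k)].
Definition pauli_phase q r : C := \prod_(k < n) pauli1_phase (q k) (r k).

Lemma pmatM q r : pmat R q *m pmat R r = pauli_phase q r *: pmat R (pstring_mul q r).
Proof.
apply/matrixP => i j; rewrite !mxE.
under eq_bigr do rewrite !mxE -big_split /=.
rewrite (sum_prod_qbit (fun k b => pauli1_entry R (q k) (qbit k i) b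
   * pauli1_entry R (r k) b (qbit k j))) -big_split /=.
by apply: eq_bigr => k _; rewrite pauli1_entryM ffunE.
Qed.

Lemma pstring_mulC q r : pstring_mul q r = pstring_mul r q.
Proof. by apply/ffunP => k; rewrite !ffunE pauli1_mulC. Qed.

Lemma pauli_phaseC q r :
  pauli_phase q r * pauli_phase r q = 1 /\ pauli_phase q r ^+ 4 = 1.
Proof.
split; rewrite /pauli_phase -?prodrXl -?big_split /= big1 // => k _;
  by have [] := pauli1_phaseC (q k) (r k).
Qed.

Lemma pmat_id : pmat R (pstring_id n) = 1%:M.
Proof.
apply/matrixP => i j; rewrite !mxE.
under eq_bigr do rewrite ffunE /pauli1_entry /=.
case: eqP => [->|nij]; first by rewrite big1 // => k _; rewrite eqxx.
have [/existsP[k /negPf kij]|] := boolP [exists k : 'I_n, qbit k i != qbit k j].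
  by rewrite (bigD1 k) //= kij mul0r.
rewrite negb_exists => /forallP h; case: nij; apply: qbit_inj => k.
by have := h k; rewrite negbK => /eqP.
Qed.

Lemma pmat_sqr q : pmat R q *m pmat R q = 1%:M.
Proof.
rewrite pmatM -pmat_id.
have -> : pstring_mul q q = pstring_id n.
  apply/ffunP => k; rewrite !ffunE; apply: val_inj.
  by case: (q k) => -[|[|[|[|//]]]].
rewrite /pauli_phase big1 ?scale1r // => k _.
by case: (q k) => -[|[|[|[|//]]]].
Qed.

Lemma adjmx_pmat q : adjmx (pmat R q) = pmat R q.
Proof.
apply/matrixP => i j; rewrite !mxE rmorph_prod.
by apply: eq_bigr => k _; exact: conj_pauli1_entry.
Qed.

(** The trace is the product of the single-qubit traces, and X, Y, Z are traceless. *)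
Lemma mxtrace_pmat q : q != pstring_id n -> \tr (pmat R q) = 0.
Proof.
move=> qid; rewrite /mxtrace; under eq_bigr do rewrite mxE.
rewrite (sum_prod_qbit (fun k b => pauli1_entry R (q k) b b)).
have [k qk] : exists k, q k != ord0.
  apply/existsP; apply: contra_neqT qid; rewrite negb_exists => /forallP h.
  by apply/ffunP => k; rewrite ffunE; have := h k; rewrite negbK => /eqP.
rewrite (bigD1 k) //=; apply/eqP; rewrite mulf_eq0; apply/orP; left.
rewrite !big_ord_recl big_ord0; move: qk.
by case: (q k) => -[|[|[|[|//]]]] ? //= _; rewrite /pauli1_entry /= ?addr0 ?subrr.
Qed.

(** Multiplying by [pmat R q] makes the identity a multiple of the string [pstring_mul q r]; taking
    traces forces that string to be the identity, hence [q = r]. *)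
Lemma pmat_scale_inj (c : C) q r : c != 0 -> pmat R q = c *: pmat R r -> q = r.
Proof.
move=> c0 qr; have := pmat_sqr q; rewrite {2}qr -scalemxAr pmatM scalerA.
have [/ffunP h _|] := eqVneq (pstring_mul q r) (pstring_id n).
  by apply/ffunP => k; have := h k; rewrite !ffunE => /pauli1_mul_eq0.
move=> /mxtrace_pmat t0 /(congr1 mxtrace); rewrite mxtraceZ t0 mulr0 mxtrace1.
by move/esym/eqP; rewrite pnatr_eq0 expn_eq0.
Qed.

Lemma pmat_neq0 q : pmat R q != 0.
Proof.
apply/eqP => q0; have := pmat_sqr q; rewrite q0 mul0mx => /(congr1 mxtrace)/eqP.
by rewrite mxtrace0 mxtrace1 eq_sym pnatr_eq0 expn_eq0.
Qed.

(** Let f be the phase of the product, so that the reversed product has phase f^3. If f^2 = 1 the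
    phases agree and f is a sign; if f^2 = -1 they are opposite. *)
Lemma pmat_comm_or_anticomm q r :
  (pmat R q *m pmat R r = pmat R r *m pmat R q /\
     exists s : bool, pmat R q *m pmat R r = (-1) ^+ s *: pmat R (pstring_mul q r))
  \/ (pmat R q *m pmat R r <> pmat R r *m pmat R q /\
      pmat R q *m pmat R r = - (pmat R r *m pmat R q)).
Proof.
have [f1 f4] := pauli_phaseC q r; rewrite !pmatM (pstring_mulC r q).
have f0 : pauli_phase q r != 0 by apply: contra_eq_neq f1 => ->; rewrite mul0r eq_sym oner_eq0.
have -> : pauli_phase r q = pauli_phase q r ^+ 3.
  by apply: (mulfI f0); rewrite f1 -exprS f4.
have /eqP : (pauli_phase q r ^+ 2) ^+ 2 = 1 by rewrite -exprM.
rewrite sqrf_eq1 => /orP[/eqP f2|/eqP f2]; rewrite [_ ^+ 3]exprSr f2; [left|right].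
  rewrite mul1r; split=> //; have /eqP := f2; rewrite sqrf_eq1 => /orP[]/eqP ->.
    by exists false.
  by exists true.
rewrite mulN1r scaleNr opprK; split=> // /eqP.
rewrite -subr_eq0 opprK -mulr2n -scaler_nat !scaler_eq0 (negPf f0) (negPf (pmat_neq0 _)).
by rewrite pnatr_eq0.
Qed.
End PauliAlgebra.

(** * Sums over paths with a fixed starting point *)

Section PathSums.
Variable T : finType.

(** Splits off the last entry of a path. Values in a module cover both the matrix expansion and the
    scalar coefficient bounds. *)
Lemma path_sumS (K : pzRingType) (V : lmodType K) L (x0 : T)
    (W : nat -> T -> T -> K) (F : T -> V) :
  \sum_(g : {ffun 'I_L.+2 -> T} | g (inord 0) == x0)
     (\prod_(t < L.+1) W t (g (inord t)) (g (inord t.+1))) *: F (g (inord L.+1))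
  = \sum_(g : {ffun 'I_L.+1 -> T} | g (inord 0) == x0)
     (\prod_(t < L) W t (g (inord t)) (g (inord t.+1))) *:
        \sum_q W L (g (inord L)) q *: F q.
Proof.
under [RHS]eq_bigr do rewrite scaler_sumr.
rewrite pair_big /=.
(* [e] appends a last entry to a path; its inverse [d] separates it again. *)
pose e (hq : {ffun 'I_L.+1 -> T} * T) : {ffun 'I_L.+2 -> T} :=
  [ffun i : 'I_L.+2 => if (i < L.+1)%N then hq.1 (inord i) else hq.2].
pose d (g : {ffun 'I_L.+2 -> T}) : {ffun 'I_L.+1 -> T} * T :=
  ([ffun i : 'I_L.+1 => g (inord i)], g (inord L.+1)).
have eE hq (t : nat) : (t < L.+1)%N -> e hq (inord t) = hq.1 (inord t).
  by move=> lt; rewrite ffunE inordK ?lt // ltnS ltnW.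
have eL hq : e hq (inord L.+1) = hq.2 by rewrite ffunE inordK // ltnn.
have e_bij : bijective e.
  exists d => [[h q]|g].
    rewrite /d eL; congr pair; apply/ffunP => i.
    by rewrite ffunE eE // inord_val.
  apply/ffunP => i; rewrite /e !ffunE /=.
  case: ifPn => [li|]; first by rewrite inordK // inord_val.
  rewrite -leqNgt => li; congr (g _); apply: val_inj; rewrite /= inordK //.
  by apply/eqP; rewrite eqn_leq li -ltnS ltn_ord.
rewrite (reindex e) /=; last exact: onW_bij.
apply: eq_big => [hq|hq _]; first by rewrite eE // andbT.
rewrite eL scalerA big_ord_recr /= eL eE //; congr (_ * _ *: _).
apply: eq_bigr => t _; rewrite !eE //; first by rewrite ltnS ltn_ord.
by rewrite ltnS ltnW.
Qed.

Lemma path_sum0 (V : nmodType) (x0 : T) (F : T -> V) :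
  \sum_(g : {ffun 'I_1 -> T} | g (inord 0) == x0) F (g (inord 0)) = F x0.
Proof.
rewrite (big_pred1 [ffun => x0]) ?ffunE // => g /=.
apply/eqP/eqP => [<-|->]; last by rewrite ffunE.
by apply/ffunP => i; rewrite ffunE; congr (g _); apply: val_inj; rewrite /= inordK // ord1.
Qed.

(** The weights act as transfer matrices: nonnegative rows of sum at most [c] cost one factor [c]
    per step. *)
Lemma path_sum_le (K : numDomainType) L (x0 : T) (W : nat -> T -> T -> K) (c : K) :
  0 <= c -> (forall t q q', 0 <= W t q q') ->
  (forall t q, (t < L)%N -> \sum_q' W t q q' <= c) ->
  \sum_(g : {ffun 'I_L.+1 -> T} | g (inord 0) == x0)
     \prod_(t < L) W t (g (inord t)) (g (inord t.+1)) <= c ^+ L.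
Proof.
move=> c0 W0; elim: L => [|L IH] Wc.
  under eq_bigr do rewrite big_ord0.
  by rewrite (path_sum0 x0 (fun=> 1)).
have := @path_sumS K K^o L x0 W (fun=> 1).
under eq_bigr do rewrite /GRing.scale /= mulr1.
move=> ->; rewrite exprSr.
apply: le_trans (_ : _ <= (\sum_(g : {ffun 'I_L.+1 -> T} | g (inord 0) == x0)
     \prod_(t < L) W t (g (inord t)) (g (inord t.+1))) * c) _.
  rewrite mulr_suml; apply: ler_sum => g _; rewrite /GRing.scale /=.
  apply: ler_wpM2l; first by apply: prodr_ge0.
  under eq_bigr do rewrite mulr1.
  exact: Wc.
by apply: ler_wpM2r => //; apply: IH => t q lt; apply: Wc; rewrite ltnS ltnW.
Qed.

Lemma prod_indicator (K : comPzRingType) L (b : 'I_L -> bool) (f : 'I_L -> K) :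
  \prod_(t < L) ((b t)%:R * f t) = [forall t, b t]%:R * \prod_(t < L) f t.
Proof.
have [/forallP h|] := boolP [forall t, b t].
  by rewrite mul1r; apply: eq_bigr => t _; rewrite h mul1r.
rewrite negb_forall => /existsP[t /negPf bt].
by rewrite mul0r (bigD1 t) //= bt !mul0r.
Qed.
End PathSums.

(** * Trace norm of a combination of Pauli strings *)

Section TraceNorm.
Variable R : realType.
Local Notation C := (R[i]).

Lemma dotmx_conj N (u : 'rV[C]_N) :
  (u *m (map_mx Num.conj u)^T) 0 0 = \sum_j `|u 0 j| ^+ 2.
Proof. by rewrite mxE; apply: eq_bigr => j _; rewrite !mxE normCK. Qed.

(** For a row eigenvector v and w = v M^*, one has |w|^2 = a |v|^2 with |v|^2 > 0. *)
Lemma eigenvalue_adj_mul_ge0 N (M : 'M[C]_N) a :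
  eigenvalue (adjmx M *m M) a -> 0 <= a.
Proof.
move=> /eigenvalueP[v va v0].
pose w := v *m adjmx M.
have wE : M *m (map_mx Num.conj v)^T = (map_mx Num.conj w)^T.
  rewrite /w map_mxM trmx_mul /adjmx -map_trmx trmxK; congr (_ *m _).
  by apply/matrixP => i j; rewrite !mxE /= conjCK.
have : (w *m (map_mx Num.conj w)^T) 0 0 = a * (v *m (map_mx Num.conj v)^T) 0 0.
  by rewrite -wE mulmxA /w -(mulmxA v) va -scalemxAl mxE.
rewrite !dotmx_conj => h.
have dv : 0 < \sum_j `|v 0 j| ^+ 2.
  rewrite lt_def sumr_ge0 ?andbT => [|j _]; last exact: exprn_ge0.
  apply: contra_neq v0 => /eqP; rewrite psumr_eq0 => [/allP z|j _]; last exact: exprn_ge0.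
  apply/rowP => j; have /= := z j (mem_index_enum _).
  by rewrite sqrf_eq0 normr_eq0 mxE => /eqP.
by rewrite -(pmulr_lge0 _ dv) -h sumr_ge0 // => j _; exact: exprn_ge0.
Qed.

Lemma mxtrace_adj_mul N (M : 'M[C]_N) :
  \tr (adjmx M *m M) = \sum_i \sum_j `|M i j| ^+ 2.
Proof.
rewrite exchange_big /=; apply: eq_bigr => j _; rewrite mxE.
by apply: eq_bigr => i _; rewrite !mxE normCK mulrC.
Qed.

(* AM-GM: [sqrt z <= (z / c + c) / 2] for each eigenvalue [z] of [M^* M]. *)
Lemma trace_norm_le N (M : 'M[C]_N) (c : C) : 0 < c ->
  \sum_i \sum_j `|M i j| ^+ 2 <= N%:R * c ^+ 2 -> trace_norm M <= N%:R * c.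
Proof.
(* In dimension 0 there are no eigenvalues; reading the trace off the characteristic polynomial
   below takes a positive dimension. *)
case: N M => [|N] M c0.
  move=> _; rewrite /trace_norm mul0r; case: closed_field_poly_normal => s /=.
  rewrite (monicP (char_poly_monic _)) scale1r => es.
  have := congr1 (fun q : {poly C} => size q) es.
  by rewrite size_char_poly size_prod_XsubC => -[/esym/size0nil ->]; rewrite big_nil.
rewrite /trace_norm -mxtrace_adj_mul.
case: closed_field_poly_normal => s /=.
rewrite (monicP (char_poly_monic _)) scale1r => es.
have szs : size s = N.+1.
  have := congr1 (fun q : {poly C} => size q) es.
  by rewrite size_char_poly size_prod_XsubC => -[].
have trs : \tr (adjmx M *m M) = \sum_(z <- s) z.
  by apply: oppr_inj; rewrite -char_poly_trace // es -szs coefPn_prod_XsubC ?szs.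
have s0 z : z \in s -> 0 <= z.
  move=> zs; apply: (@eigenvalue_adj_mul_ge0 _ M).
  by rewrite eigenvalue_root_char es root_prod_XsubC.
rewrite trs => h.
(* After multiplication by 2c the termwise inequality is 2c sqrt z <= z + c^2, that is, (sqrt z -
   c)^2 >= 0. *)
have c2 : 0 < c * 2 by rewrite mulr_gt0.
rewrite -(ler_pM2r c2) mulr_suml.
apply: le_trans (_ : _ <= \sum_(z <- s) (z + c ^+ 2)) _.
  rewrite !big_seq; apply: ler_sum => z /s0 z0.
  have : 0 <= (sqrtC z - c) ^+ 2.
    by rewrite real_exprn_even_ge0 // rpredB // ger0_real ?sqrtC_ge0 // ltW.
  by rewrite sqrrB sqrtCK addrAC subr_ge0 mulrA mulr_natr.
rewrite big_split /= big_const_seq count_predT szs iter_addr_0.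
apply: le_trans (lerD h (lexx _)) _.
by rewrite -[c ^+ 2 *+ _]mulr_natl expr2 le_eqVlt; apply/orP; left; apply/eqP; ring.
Qed.

Variable n : nat.

Lemma sum_pmat_sqr (q : pstring n) :
  \sum_i \sum_j `|pmat R q i j| ^+ 2 = (2 ^ n)%:R.
Proof. by rewrite -mxtrace_adj_mul adjmx_pmat pmat_sqr mxtrace1. Qed.

(** Entrywise 2ab <= a^2 + b^2, and each string has squared Frobenius norm 2^n. *)
Lemma sum_pmat_mul_le (q r : pstring n) :
  \sum_i \sum_j `|pmat R q i j| * `|pmat R r i j| <= (2 ^ n)%:R.
Proof.
have t0 : (0 : C) < 2 by [].
rewrite -(ler_pM2r t0) mulr_suml.
have -> : (2 ^ n)%:R * 2 = \sum_i \sum_j `|pmat R q i j| ^+ 2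
                          + \sum_i \sum_j `|pmat R r i j| ^+ 2 :> C.
  by rewrite !sum_pmat_sqr mulr_natr mulr2n.
rewrite -big_split /=; apply: ler_sum => i _.
rewrite -big_split mulr_suml /=; apply: ler_sum => j _.
have : 0 <= (`|pmat R q i j| - `|pmat R r i j|) ^+ 2.
  by rewrite real_exprn_even_ge0 // rpredB // normr_real.
by rewrite sqrrB addrAC subr_ge0 mulr_natr.
Qed.

(** Different [g] may carry the same string, so the squared Frobenius norm is expanded as a double
    sum and every cross term is bounded by 2^n, giving 2^n S^2 with S the sum of the [|a g|]. *)
Lemma trace_norm_sum_pmat_le (I : finType) (P : pred I) (a : I -> C)
    (q : I -> pstring n) (c : C) :
  0 < c -> \sum_(g | P g) `|a g| <= c ->
  trace_norm (\sum_(g | P g) a g *: pmat R (q g)) <= (2 ^ n)%:R * c.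
Proof.
move=> c0 ac; apply: trace_norm_le => //.
set S := \sum_(g | P g) `|a g| in ac.
have S0 : 0 <= S by apply: sumr_ge0.
apply: le_trans (_ : _ <= (2 ^ n)%:R * S ^+ 2) _; last first.
  by rewrite ler_wpM2l // ler_pXn2r // nnegrE // ltW.
apply: le_trans (_ : _ <= \sum_i \sum_j \sum_(g | P g) \sum_(h | P h)
   `|a g| * `|a h| * (`|pmat R (q g) i j| * `|pmat R (q h) i j|)) _.
  apply: ler_sum => i _; apply: ler_sum => j _.
  apply: le_trans (_ : _ <= (\sum_(g | P g) `|a g| * `|pmat R (q g) i j|) ^+ 2) _.
    rewrite ler_pXn2r ?nnegrE ?normr_ge0 ?sumr_ge0 // => [|g _]; last exact: mulr_ge0.
    rewrite summxE; apply: le_trans (ler_norm_sum _ _ _) _.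
    by apply: ler_sum => g _; rewrite mxE normrM.
  rewrite expr2 big_distrlr /=; apply: ler_sum => g _; apply: ler_sum => h _.
  by rewrite mulrACA.
under eq_bigr do rewrite exchange_big /=.
rewrite exchange_big /= expr2 big_distrlr /= mulr_sumr; apply: ler_sum => g _.
under eq_bigr do rewrite exchange_big /=.
rewrite exchange_big /= mulr_sumr; apply: ler_sum => h _.
under eq_bigr do rewrite -mulr_sumr.
rewrite -mulr_sumr mulrC; apply: ler_wpM2r; first exact: mulr_ge0.
exact: sum_pmat_mul_le.
Qed.
End TraceNorm.

(** * Hyperbolic identities and an exponential bound *)

Section RealBounds.
Variable R : realType.
Implicit Types x tau : R.

Lemma expR_half tau : expR tau = expR (tau / 2) ^+ 2.
Proof. by rewrite expr2 -expRD -splitr. Qed.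

(** The generators are exponentials at tau / 2 while step factors are taken at tau; double-argument
    formulas connect them. *)
Lemma coshR_half tau : coshR tau = coshR (tau / 2) ^+ 2 + sinhR (tau / 2) ^+ 2.
Proof. by rewrite /coshR /sinhR !(expR_half tau) (expR_half (- tau)) mulNr; field. Qed.

Lemma sinhR_half tau : sinhR tau = 2 * coshR (tau / 2) * sinhR (tau / 2).
Proof. by rewrite /coshR /sinhR (expR_half tau) (expR_half (- tau)) mulNr; field. Qed.

Lemma coshR2_sinhR2 tau : coshR tau ^+ 2 - sinhR tau ^+ 2 = 1.
Proof. by rewrite -[RHS](expRxMexpNx_1 tau) /coshR /sinhR; field. Qed.

Lemma sinhR_ge0 tau : 0 <= tau -> 0 <= sinhR tau.
Proof. by move=> t0; rewrite /sinhR divr_ge0 // subr_ge0 ler_expR; lra. Qed.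

Lemma coshR_ge1 tau : 1 <= coshR tau.
Proof.
by rewrite /coshR; have := expR_ge1Dx tau; have := expR_ge1Dx (- tau); lra.
Qed.

Lemma coshR_ge0 tau : 0 <= coshR tau.
Proof. exact: le_trans ler01 (coshR_ge1 tau). Qed.

(** Both sides are compared with e^tau (1 + x tau), using cosh tau <= e^tau and sinh tau <= tau
    e^tau. *)
Lemma coshR_sinhR_le_expR x tau : 0 <= x -> 0 <= tau ->
  coshR tau + x * sinhR tau <= expR (tau + x * tau).
Proof.
move=> x0 t0; rewrite expRD.
apply: le_trans (_ : _ <= expR tau * (1 + x * tau)) _; last first.
  by rewrite ler_wpM2l ?expR_ge0 // expR_ge1Dx.
have e1 : expR (- tau) <= expR tau by rewrite ler_expR; lra.
(* This is 1 - 2 tau <= e^(-2 tau) multiplied by e^tau. *)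
have h : sinhR tau <= tau * expR tau.
  have := expR_ge1Dx (- tau - tau); rewrite expRD /sinhR => h.
  have /(ler_wpM2r (expR_ge0 tau)) := h.
  rewrite -mulrA [expR (- tau) * expR tau]mulrC expRxMexpNx_1; lra.
have : coshR tau <= expR tau by rewrite /coshR; lra.
have := ler_wpM2l x0 h; lra.
Qed.
End RealBounds.

(** * Single updates and the Pauli-path expansion *)

Lemma mulmx_conj_affine (K : comPzRingType) N (c s : K) (P Q : 'M[K]_N) :
  (c *: 1%:M - s *: P) *m Q *m (c *: 1%:M - s *: P) =
  c ^+ 2 *: Q - (c * s) *: (P *m Q + Q *m P) + s ^+ 2 *: (P *m Q *m P).
Proof.
rewrite mulmxBl mulmxBr !mulmxBl -!(scalemxAl, scalemxAr) !mul1mx !mulmx1.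
by rewrite !scalerA scalerDr opprB opprD !expr2 !addrA [LHS]addrAC.
Qed.

Section PauliPaths.
Variables (R : realType) (n : nat) (tau : R) (sg : nat -> bool) (p : nat -> pstring n).
Local Notation C := (R[i]).
Implicit Types (q : pstring n) (t : nat).

Definition step_ok t q q' : bool :=
  [|| step_a R sg p t q q', step_b R sg p t q q' | step_c R sg p t q q'].

Lemma genP_sqr t : genP R sg p t *m genP R sg p t = 1%:M.
Proof.
by rewrite /genP -scalemxAl -scalemxAr pmat_sqr scalerA -expr2 sqrr_sign scale1r.
Qed.

Lemma genP_pmat t q :
  (~~ commutes (genP R sg p t) (pmat R q)
     /\ genP R sg p t *m pmat R q = - (pmat R q *m genP R sg p t))
  \/ (commutes (genP R sg p t) (pmat R q)
     /\ exists (s : bool) q1, genP R sg p t *m pmat R q = (-1) ^+ s *: pmat R q1).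
Proof.
have s0 : (-1) ^+ sg t != 0 :> C by rewrite signr_eq0.
have [[pq [s e]]|[npq pq]] := pmat_comm_or_anticomm R (p t) q; [right|left].
  split; first by rewrite /commutes /genP -scalemxAl -scalemxAr pq.
  exists (sg t (+) s), (pstring_mul (p t) q).
  by rewrite /genP -scalemxAl e scalerA signr_addb.
split; last by rewrite /genP -scalemxAl -scalemxAr pq scalerN.
by apply: contra_notN npq => /eqP; rewrite /genP -scalemxAl -scalemxAr => /(scalerI s0).
Qed.

(** An entry has either itself as only successor, or exactly two distinct successors; distinctness
    keeps cases (b) and (c) disjoint. *)
Variant step_spec t q : Prop :=
| StepAnti of genP R sg p t *m pmat R q = - (pmat R q *m genP R sg p t)
    & (forall q', step_ok t q q' = (q' == q))
    & (forall q', step_ok t q q' -> step_c R sg p t q q' = false)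
    & step_factor tau sg p t q q = 1
| StepComm (s : bool) q1 of genP R sg p t *m pmat R q = pmat R q *m genP R sg p t
    & genP R sg p t *m pmat R q = (-1) ^+ s *: pmat R q1
    & q1 != q
    & (forall q', step_ok t q q' = (q' == q) || (q' == q1))
    & (forall q', step_c R sg p t q q' = (q' == q1))
    & step_factor tau sg p t q q = rC (coshR tau)
    & step_factor tau sg p t q q1 = - ((-1) ^+ s * rC (sinhR tau)).

Lemma stepP t q : p t != pstring_id n -> step_spec t q.
Proof.
move=> pid; have [[nc pq]|[c [s [q1 e]]]] := genP_pmat t q.
  apply: StepAnti => // [q'|q'|].
  - by rewrite /step_ok /step_a /step_b /step_c nc (negPf nc) /= orbF.
  - by rewrite /step_c (negPf nc).
  - by rewrite /step_factor /step_a nc eqxx.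
(* If [q1 = q], cancelling [pmat R q] would make the generator plus or minus the identity. *)
have q1q : q1 != q.
  apply: contra_neq pid => q1q; rewrite q1q in e.
  apply: (@pmat_scale_inj R n ((-1) ^+ sg t * (-1) ^+ s)).
    by rewrite mulf_neq0 // signr_eq0.
  have := congr1 (mulmx^~ (pmat R q)) e.
  rewrite -[LHS]mulmxA -[RHS]scalemxAl pmat_sqr mulmx1 -scalerA pmat_id => <-.
  by rewrite /genP scalerA -expr2 sqrr_sign scale1r.
have cq q' : step_c R sg p t q q' = (q' == q1).
  rewrite /step_c c /= e; apply/orP/eqP => [[]/eqP h|->].
  - by apply/esym/(@pmat_scale_inj R n ((-1) ^+ s)); rewrite ?signr_eq0 // -h scalerA -expr2 sqrr_sign scale1r.
  - apply/(@pmat_scale_inj R n (- (-1) ^+ s)); first by rewrite oppr_eq0 signr_eq0.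
    by rewrite scaleNr h opprK.
  - by case: s {e}; [right|left]; rewrite ?expr0 ?expr1 ?scale1r ?scaleN1r.
have b0 : step_b R sg p t q q1 = false by rewrite /step_b c (negPf q1q).
have a0 q' : step_a R sg p t q q' = false by rewrite /step_a c.
apply: (StepComm (s := s) (q1 := q1)) => // [|q'||].
- exact/eqP.
- by rewrite /step_ok a0 cq /step_b c.
- by rewrite /step_factor a0 /step_b c eqxx.
(* [step_factor] tests the sign +1 first; for s = -1 that test fails because [pmat R q1] is nonzero
   and so differs from its negative. *)
- rewrite /step_factor a0 b0 e; case: s {e} => /=.
    rewrite expr1 scaleN1r mulN1r opprK; case: eqP => // /eqP.
    rewrite eq_sym -subr_eq0 opprK -mulr2n -scaler_nat scaler_eq0 pnatr_eq0 /=.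
    by rewrite (negPf (pmat_neq0 _ _)).
  by rewrite expr0 scale1r eqxx mul1r.
Qed.

(** Illegal steps get weight 0, so sums may run over all sequences from the identity string. *)
Definition step_weight t q q' : C := (step_ok t q q')%:R * step_factor tau sg p t q q'.

Lemma sum_step_ok (V : lmodType C) t q (w : pstring n -> C) (F : pstring n -> V) :
  \sum_q' ((step_ok t q q')%:R * w q') *: F q' = \sum_(q' | step_ok t q q') w q' *: F q'.
Proof.
rewrite [RHS]big_mkcond; apply: eq_bigr => q' _.
by case: ifP => _; rewrite ?mul1r // mul0r scale0r.
Qed.

Lemma expGen_conj t q : p t != pstring_id n ->
  expGen tau sg p t *m pmat R q *m expGen tau sg p t
  = \sum_q' step_weight t q q' *: pmat R q'.
Proof.
move=> pid; rewrite sum_step_ok.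
set c := rC (coshR (tau / 2)); set s := rC (sinhR (tau / 2)).
have -> : expGen tau sg p t *m pmat R q *m expGen tau sg p t =
  c ^+ 2 *: pmat R q - (c * s) *: (genP R sg p t *m pmat R q + pmat R q *m genP R sg p t)
  + s ^+ 2 *: (genP R sg p t *m pmat R q *m genP R sg p t).
  exact: mulmx_conj_affine.
(* With c, s at tau / 2: anticommutation kills the middle term and gives PQP = -Q, leaving (c^2 -
   s^2) Q = Q; commutation gives (c^2 + s^2) Q - 2cs PQ. *)
have [pq ok _ f1|s1 q1 pq e q1q ok cq f0 f1] := stepP q pid.
  rewrite (big_pred1 q) // f1 scale1r pq addNr scaler0 subr0 mulNmx -mulmxA genP_sqr mulmx1.
  rewrite scalerN -scalerBl /c /s /rC -!rmorphXn -rmorphB coshR2_sinhR2.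
  by rewrite rmorph1 scale1r.
rewrite (bigD1 q) /=; last by rewrite ok eqxx.
rewrite (big_pred1 q1); last first.
  by move=> q' /=; rewrite ok; case: eqP => //= [->|]; rewrite ?andbF ?andbT // eq_sym (negPf q1q).
have -> : step_factor tau sg p t q q1 *: pmat R q1
    = - (rC (sinhR tau) *: (genP R sg p t *m pmat R q)).
  by rewrite f1 e scaleNr scalerA mulrC.
rewrite f0 -pq.
rewrite [X in _ *: (X *m _)]pq -mulmxA genP_sqr mulmx1 addrAC -scalerDl -mulr2n.
rewrite -scaler_nat scalerA; congr (_ *: _ - _ *: _).
  by rewrite coshR_half /rC rmorphD !rmorphXn.
rewrite sinhR_half /rC (rmorphM _ (2 * coshR (tau / 2))) (rmorphM _ 2) rmorph_nat.
by rewrite -/(rC _) -/(rC _) -/c -/s; ring.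
Qed.

Lemma is_path_coef L (g : {ffun 'I_L.+1 -> pstring n}) :
  g (inord 0) == pstring_id n ->
  \prod_(t < L) step_weight t (g (inord t)) (g (inord t.+1))
  = (is_path R sg p g)%:R * coef tau sg p g.
Proof. by move=> g0; rewrite prod_indicator /is_path /path_at g0. Qed.

(** Induction on [L]: conjugation is linear and expands each last entry over its successors.
    Sequences that are not paths then drop out with weight 0. *)
Lemma Aop_path_sum L : (forall t, (t < L)%N -> p t != pstring_id n) ->
  Aop tau sg p L = \sum_(g : {ffun 'I_L.+1 -> pstring n} | is_path R sg p g)
     coef tau sg p g *: pmat R (path_at g L).
Proof.
move=> pid.
have -> : Aop tau sg p L = \sum_(g : {ffun 'I_L.+1 -> pstring n} | g (inord 0) == pstring_id n)
   (\prod_(t < L) step_weight t (g (inord t)) (g (inord t.+1))) *: pmat R (g (inord L)).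
  elim: L pid => [|L IH] pid /=.
    under eq_bigr do rewrite big_ord0 scale1r.
    by rewrite (path_sum0 _ (fun q => pmat R q)) pmat_id.
  rewrite IH => [|t lt]; last by apply: pid; rewrite ltnS ltnW.
  rewrite path_sumS mulmx_sumr mulmx_suml; apply: eq_bigr => g _.
  by rewrite -scalemxAr -scalemxAl expGen_conj // pid.
rewrite [RHS]big_mkcond [LHS]big_mkcond /=; apply: eq_bigr => g _.
case: ifPn => g0; last by rewrite /is_path /path_at (negPf g0).
by rewrite is_path_coef //; case: is_path; rewrite ?mul1r // mul0r scale0r.
Qed.

(** * Weighted sums of path coefficients *)

Lemma rC_ge0 (x : R) : 0 <= x -> 0 <= rC x.
Proof. by move=> x0; rewrite /rC -(rmorph0 (real_complex R)) lecR. Qed.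

(** A commuting step gives exactly cosh tau + x sinh tau; an anticommuting one gives 1 <= cosh
    tau. *)
Lemma step_weight_sum_le t q (x : R) : 0 <= x -> 0 <= tau -> p t != pstring_id n ->
  \sum_q' `|step_weight t q q'| * rC x ^+ step_c R sg p t q q'
  <= rC (coshR tau + x * sinhR tau).
Proof.
move=> x0 t0 pid.
have sh0 := sinhR_ge0 t0; have ch1 := coshR_ge1 tau.
have -> : \sum_q' `|step_weight t q q'| * rC x ^+ step_c R sg p t q q' =
  \sum_(q' | step_ok t q q') `|step_factor tau sg p t q q'| * rC x ^+ step_c R sg p t q q'.
  rewrite [RHS]big_mkcond; apply: eq_bigr => q' _; rewrite /step_weight.
  by case: ifP => _; rewrite ?mul1r // mul0r normr0 mul0r.
have [pq ok cq f1|s1 q1 pq e q1q ok cq f0 f1] := stepP q pid.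
  rewrite (big_pred1 q) // cq ?ok ?eqxx // f1 normr1 mulr1 -(rmorph1 (real_complex R)) lecR.
  by rewrite (le_trans ch1) // lerDl mulr_ge0.
rewrite (bigD1 q) /=; last by rewrite ok eqxx.
rewrite (big_pred1 q1); last first.
  by move=> q' /=; rewrite ok; case: eqP => //= [->|]; rewrite ?andbF ?andbT // eq_sym (negPf q1q).
rewrite !cq eqxx eq_sym (negPf q1q) f0 f1 expr0 expr1 mulr1 normrN normrM normr_sign mul1r.
by rewrite !ger0_norm ?rC_ge0 ?coshR_ge0 // /rC rmorphD (rmorphM _ x) mulrC.
Qed.

(** A Chernoff-type estimate: since x >= 1, a path with r > k updates has x^k <= x^r, and the sum
    weighted by x^r factors step by step. *)
Lemma tail_coef_sum_le L k (x : R) : 1 <= x -> 0 <= tau ->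
  (forall t, (t < L)%N -> p t != pstring_id n) ->
  rC x ^+ k * \sum_(g : {ffun 'I_L.+1 -> pstring n}
                     | is_path R sg p g && ~~ (nupdates R sg p g <= k)%N) `|coef tau sg p g|
  <= rC (coshR tau + x * sinhR tau) ^+ L.
Proof.
move=> x1 t0 pid.
have x0 : 0 <= x by rewrite (le_trans ler01).
have X1 : 1 <= rC x by rewrite /rC -(rmorph1 (real_complex R)) lecR.
pose W t q q' := `|step_weight t q q'| * rC x ^+ step_c R sg p t q q'.
have W0 t q q' : 0 <= W t q q' by rewrite mulr_ge0 // exprn_ge0 // rC_ge0.
apply: le_trans (path_sum_le (pstring_id n) _ W0 _); last first.
- by move=> t q lt; apply: step_weight_sum_le => //; apply: pid.
- by rewrite rC_ge0 // addr_ge0 ?coshR_ge0 // mulr_ge0 // sinhR_ge0.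
rewrite mulr_sumr [leLHS]big_mkcond [leRHS]big_mkcond; apply: ler_sum => g _ /=.
have [/andP[gp gk]|_] := ifPn; last by case: ifP => // _; rewrite prodr_ge0.
have g0 : g (inord 0) == pstring_id n by case/andP: gp.
rewrite g0 big_split -normr_prod is_path_coef // gp mul1r mulrC /=.
apply: ler_wpM2l => //; rewrite prodrXr.
by apply: ler_weXn2l => //; rewrite ltnW // ltnNge.
Qed.
End PauliPaths.

(** * Choice of the weight and conclusion *)

Theorem mainTheorem7 (R : realType) (n : nat) (tau : R) (L : nat)
  (sg : nat -> bool) (p : nat -> pstring n) (k : nat) :
  (1 <= n)%N -> 0 < tau -> (1 <= L)%N ->
  (forall t, (t < L)%N -> p t != pstring_id n) ->
  expR 1 * L%:R * tau < k%:R ->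
  trace_norm (Aop tau sg p L - Atrunc tau L sg p k)
    <= rC (2 ^+ n * expR (tau * L%:R) * (expR 1 * L%:R * tau / k%:R) ^+ k).
Proof.
move=> _ tau0 L1 pid ek.
have Lt0 : 0 < L%:R * tau :> R by rewrite mulr_gt0 // ltr0n.
have e1 : 1 <= expR 1 :> R by rewrite (le_trans _ (expR_ge1Dx 1)) // lerDl.
have k0 : 0 < k%:R :> R by apply: le_lt_trans ek; rewrite -mulrA mulr_ge0 ?expR_ge0 // ltW.
(* The minimiser of e^(x tau L) / x^k; the assumption on [k] gives x >= 1. *)
pose x : R := k%:R / (L%:R * tau).
have x1 : 1 <= x.
  by rewrite ler_pdivlMr // mul1r (le_trans _ (ltW ek)) // -mulrA ler_peMl // ltW.
have x0 : 0 < x by exact: lt_le_trans ltr01 x1.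
have B0 : 0 < expR (tau * L%:R) * (expR 1 * L%:R * tau / k%:R) ^+ k.
  by rewrite mulr_gt0 ?expR_gt0 // exprn_gt0 // divr_gt0 // -mulrA mulr_gt0 ?expR_gt0.
(* As x L tau = k, the factor e^(x tau L) is e^k, and e^k = x^k (e / x)^k with e / x = e L tau /
   k. *)
have xB : expR (tau + x * tau) ^+ L
    = x ^+ k * (expR (tau * L%:R) * (expR 1 * L%:R * tau / k%:R) ^+ k).
  rewrite mulrCA -exprMn.
  have -> : x * (expR 1 * L%:R * tau / k%:R) = expR 1.
    by rewrite /x; field; rewrite !gt_eqF //= ltr0n.
  rewrite -!expRM_natl mulr1 -expRD; congr expR.
  by rewrite /x; field; rewrite !gt_eqF //= ltr0n.
(* The paths with at most [k] updates cancel against [Atrunc], leaving the tail. *)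
rewrite /Atrunc Aop_path_sum // (bigID (fun g => (nupdates R sg p g <= k)%N)) /= addrAC subrr add0r.
rewrite -mulrA /rC rmorphM rmorphXn rmorph_nat -natrX.
apply: trace_norm_sum_pmat_le; first by rewrite -(rmorph0 (real_complex R)) ltcR.
have X0 : 0 < rC x ^+ k by rewrite exprn_gt0 // /rC -(rmorph0 (real_complex R)) ltcR.
rewrite -(ler_pM2l X0); apply: le_trans (tail_coef_sum_le _ _ x1 (ltW tau0) pid) _.
rewrite /rC -!rmorphXn -rmorphM lecR -xB.
have ch0 : 0 <= coshR tau + x * sinhR tau.
  by rewrite addr_ge0 ?coshR_ge0 // mulr_ge0 ?sinhR_ge0 ?ltW.
by rewrite ler_pXn2r ?nnegrE ?expR_ge0 //; exact: coshR_sinhR_le_expR (ltW x0) (ltW tau0).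
Qed.
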